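(* Let $\alpha\in(0,1)$. Let $W$ be the true matrix of input-output linkages with all of the data for a network of $N$ firm-good ordered pairs, and let $U$ be the observed matrix of the input-output linkages with data missing for the network of $N$ firm-good ordered pairs. Suppose that for each $i=1,\dots,N$, the missing data accounts for at most a $\delta$ share of the total intermediate input use of the good $g_i$ from firm $f_i$, where $0\le\delta<1$. If $q_U$ denotes the firm importance score vector calculated with the missing data and $q_W$ denotes the true firm importance score vector, then the maximum possible value of $\|q_U-q_W\|_p$ is $\Theta(\delta)$ for all $p\ge1$, where the constants in the bound depend on $\alpha$.
   Context: A network of $N$ firm-good ordered pairs has $N$ distinct vertices $v_i=(f_i,g_i)$, $i=1,\dots,N$, where $f_i$ is a firm and $g_i$ is a good produced by firm $f_i$ (the same firm may occur in several vertices, and so may the same good). Let $\mathcal F$ be the set of firms occurring. For each $i,j$ there is a criticality $c_{i,j}\ge0$ of good $g_j$ from firm $f_j$ to the production of good $g_i$ from firm $f_i$ ($c_{i,j}=0$ if the former is not used in the production of the latter), with $\sum_kc_{i,k}>0$ for each $i$. The linkage matrix is $W=(w_{ij})$ with $w_{ij}=c_{i,j}/\sum_{k=1}^Nc_{i,k}$; it is assumed that $w_{ii}=0$ for all $i$. Missing data: only amounts $\tilde c_{i,j}$ with $0\le\tilde c_{i,j}\le c_{i,j}$ are observed. ''The missing data accounts for at most a $\delta$ share of the total intermediate input use of good $g_i$ from firm $f_i$'' means $\sum_j\tilde c_{i,j}\ge(1-\delta)\sum_jc_{i,j}$. The observed matrix is $U=(u_{ij})$ with $u_{ij}=\tilde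 c_{i,j}/\sum_k\tilde c_{i,k}$. For a linkage matrix $A$ ($A=W$ or $U$), with transpose $A'$, let $u_A=\frac{\alpha}{N}(I-(1-\alpha)A')^{-1}\vec{\mathbf 1}\in\mathbb R^N$ be its influence vector, with coordinates $u_{A,i}$, where $\vec{\mathbf 1}$ is the all-ones vector. The importance score of firm $f$ is $q_{A,f}=\sum_{i:\,f_i=f}u_{A,i}$, and $q_A=(q_{A,f})_{f\in\mathcal F}$ is the firm importance score vector. $\|v\|_p=(\sum_i|v_i|^p)^{1/p}$. For functions of $\delta\in(0,1)$, $f(\delta)=O(g(\delta))$ means that there are constants $D,K>0$ with $f(\delta)\le Kg(\delta)$ for all $\delta\in(0,D)$; $f(\delta)=\Omega(g(\delta))$ means that there are constants $D,K>0$ with $f(\delta)\ge Kg(\delta)$ for all $\delta\in(0,D)$; $f=\Theta(g)$ means both.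
   Formalization: The lower bound Ω(δ) is stated for N ≥ 3 and the maximum and O(δ) for N ≥ 2: for N = 1 no network exists, and for N = 2 the zero diagonal forces U = W, so the maximum is 0 and Ω(δ) fails. *)

(* Defs.v *)
From HB Require Import structures.
From mathcomp Require Import all_boot all_order all_algebra.
From mathcomp Require Import all_classical all_reals all_analysis.

Set Implicit Arguments.
Unset Strict Implicit.
Unset Printing Implicit Defensive.

Import Order.TTheory GRing.Theory Num.Theory.

Local Open Scope classical_set_scope.
Local Open Scope ring_scope.

Definition linkage (R : realType) (N : nat) (c : 'M[R]_N) : 'M[R]_N :=
  \matrix_(i, j) (c i j / \sum_k c i k).

(* [firm_label] and [good_label] are ambient label types: only the labels
   attached to some vertex belong to the network. *)
Record network (R : realType) (N : nat) := Network {
  firm_label : finType;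
  good_label : finType;
  firm : 'I_N -> firm_label;
  good : 'I_N -> good_label;
  vertex_inj : injective (fun i => (firm i, good i));
  criticality : 'M[R]_N;
  criticality_ge0 : forall i j, 0 <= criticality i j;
  criticality_sum_gt0 : forall i, 0 < \sum_k criticality i k;
  linkage_diag0 : forall i, linkage criticality i i = 0
}.

Definition observed_data (R : realType) (N : nat) (c ct : 'M[R]_N) : Prop :=
  forall i j, 0 <= ct i j <= c i j.

Definition missing_share_le (R : realType) (N : nat) (delta : R)
    (c ct : 'M[R]_N) : Prop :=
  forall i, (1 - delta) * \sum_j c i j <= \sum_j ct i j.

(* For a row-stochastic [A] and 0 < alpha < 1 the matrix being inverted is in
   [unitmx], so [invmx] is the genuine inverse. *)
Definition influence (R : realType) (N : nat) (alpha : R) (A : 'M[R]_N) :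
    'cV[R]_N :=
  (alpha / N%:R) *:
    (invmx (1%:M - (1 - alpha) *: A^T) *m (const_mx 1 : 'cV[R]_N)).

Definition importance (R : realType) (N : nat) (alpha : R) (G : network R N)
    (A : 'M[R]_N) (f : firm_label G) : R :=
  \sum_(i | firm G i == f) influence alpha A i ord0.

(* The l^p norm of a real vector indexed by the finite set [S]. *)
Definition lpnorm (R : realType) (I : finType) (p : R) (S : {set I})
    (v : I -> R) : R :=
  (\sum_(x in S) `|v x| `^ p) `^ p^-1.

Definition occurring_firms (R : realType) (N : nat) (G : network R N) :
    {set firm_label G} :=
  [set firm G i | i : 'I_N]%SET.

Definition importance_error (R : realType) (N : nat) (alpha p : R)
    (G : network R N) (ct : 'M[R]_N) : R :=
  lpnorm p (occurring_firms G)
    (fun f => importance alpha (linkage ct) f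
              - importance alpha (linkage (criticality G)) f).

Definition possible_errors (R : realType) (alpha : R) (N : nat) (p delta : R) :
    set R :=
  [set e | exists (G : network R N) (ct : 'M[R]_N),
     [/\ observed_data (criticality G) ct,
         missing_share_le delta (criticality G) ct
       & e = importance_error alpha p G ct]].

Definition is_maximum (R : realType) (E : set R) (m : R) : Prop :=
  E m /\ ubound E m.

(* [f = O(g)] and [f = Omega(g)] as the argument tends to 0 from above, with
   explicit constants so that uniformity in parameters can be expressed. *)
Definition bigO_with (R : realType) (D K : R) (f g : R -> R) : Prop :=
  forall delta, 0 < delta < D -> f delta <= K * g delta.

Definition bigOmega_with (R : realType) (D K : R) (f g : R -> R) : Prop :=
  forall delta, 0 < delta < D -> K * g delta <= f delta.

(* Main.v *)
Require Import Defs.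
From HB Require Import structures.
From mathcomp Require Import all_boot all_order all_algebra.
From mathcomp Require Import all_classical all_reals all_analysis.
From mathcomp Require Import lra ring zify.

(* With W and U the true and observed linkage matrices, a pair (W, U) of
   row-stochastic matrices, W with zero diagonal, arises from data missing at
   most a share delta iff (1 - delta) U <= W entrywise.  The influence vectors
   solve x = alpha/N + (1 - alpha) U' x and y = alpha/N + (1 - alpha) W' y.

   Maximum: the error depends on the firms only through the partition of the
   vertices they induce; for each of these finitely many partitions it is a
   continuous function on the compact set of quadruples (W, U, y, x).

   Upper bound: the l^p norm is at most the l^1 norm, and aggregating over firms
   does not increase the latter.  Subtracting the two equations,
   x - y = (1 - alpha) (W' (x - y) + (U - W)' x), where the rows of U - W have
   l^1 norm at most 2 delta and x has l^1 norm at most 1, so that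
   alpha |x - y|_1 <= 2 (1 - alpha) delta.

   Lower bound: the l^p norm is at least any coordinate, and with one firm per
   vertex a single score can be moved by (1 - alpha) alpha delta / 3. *)

Set Implicit Arguments.
Unset Strict Implicit.
Unset Printing Implicit Defensive.

Import Order.TTheory GRing.Theory Num.Theory.
Import numFieldNormedType.Exports.

Local Open Scope classical_set_scope.
Local Open Scope ring_scope.

(** * Influence vectors of row-stochastic matrices *)

Section Influence.
Variables (R : realType) (N : nat) (alpha : R).
Hypothesis halpha : 0 < alpha < 1.
Implicit Types (A U W : 'M[R]_N) (x y b : 'I_N -> R).

Definition row_stochastic A :=
  (forall i j, 0 <= A i j) /\ (forall i, \sum_j A i j = 1).

(** The source [b] is left arbitrary because kernel vectors and differences of influence vectors
    solve the same equation with other sources. *)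
Definition influence_eq A b x :=
  forall i, x i = b i + (1 - alpha) * \sum_j A j i * x j.

Lemma row_stochastic_fun (r : 'I_N -> 'I_N) :
  row_stochastic (\matrix_(i, j) (j == r i)%:R).
Proof.
split=> [i j|i]; first by rewrite mxE ler0n.
under eq_bigr do rewrite mxE.
by rewrite (bigD1 (r i))//= eqxx big1 ?addr0// => j /negPf ->.
Qed.

(** Since the rows of [A] sum to 1, its transpose does not increase the l^1 norm; the term
    [(1 - alpha) * S] is then absorbed on the left. *)
Lemma influence_eq_l1 A b x : row_stochastic A -> influence_eq A b x ->
  alpha * \sum_i `|x i| <= \sum_i `|b i|.
Proof.
have /andP[alpha_gt0 alpha_lt1] := halpha.
move=> [A0 A1] xE.
have absorb (S B : R) : S <= B + (1 - alpha) * S -> alpha * S <= B by lra.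
apply: absorb.
have -> : (1 - alpha) * \sum_i `|x i|
    = \sum_i (1 - alpha) * \sum_j A j i * `|x j|.
  rewrite -mulr_sumr exchange_big; congr (_ * _); apply: eq_bigr => j _ /=.
  by rewrite -mulr_suml A1 mul1r.
rewrite -big_split; apply: ler_sum => i _ /=; rewrite {1}xE.
apply: (le_trans (ler_normD _ _)); rewrite lerD2l normrM.
rewrite [`|1 - alpha|]ger0_norm; last by lra.
rewrite ler_wpM2l//; first by lra.
apply: (le_trans (ler_norm_sum _ _ _)); apply: ler_sum => j _.
by rewrite normrM ger0_norm.
Qed.

(** A kernel vector solves the equation with source 0, so the l^1 bound makes it vanish. *)
Lemma unitmx_influence A : row_stochastic A ->
  1%:M - (1 - alpha) *: A^T \in unitmx.
Proof.
have /andP[alpha_gt0 alpha_lt1] := halpha.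
move=> hA; rewrite -unitmx_tr -row_free_unit; apply: inj_row_free => v vA0.
have vE : influence_eq A (fun=> 0) (v 0).
  move=> i; have /rowP/(_ i) := vA0.
  rewrite linearB /= linearZ /= trmxK trmx1 mulmxBr mulmx1 -scalemxAr !mxE.
  move=> /eqP; rewrite subr_eq0 => /eqP ->; rewrite add0r.
  by congr (_ * _); apply: eq_bigr => j _; rewrite mulrC.
have := influence_eq_l1 hA vE.
rewrite [X in _ <= X]big1 => [|i _]; last by rewrite normr0.
have S0 : 0 <= \sum_i `|v 0 i| by apply: sumr_ge0.
move=> S1; have {S0 S1} : \sum_i `|v 0 i| = 0 by nra.
move/psumr_eq0P => v0; apply/rowP => i; rewrite mxE.
by apply/normr0_eq0/v0.
Qed.

(** Trades the inverse matrix for a linear system, which is easier to estimate and is a closed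
    condition in [A] and [x]. *)
Lemma influenceP A x : row_stochastic A ->
  influence_eq A (fun=> alpha / N%:R) x <->
  forall i, x i = influence alpha A i ord0.
Proof.
have /andP[alpha_gt0 alpha_lt1] := halpha.
move=> hA; have uA := unitmx_influence hA; set b := fun=> _.
have mxE1 y i : ((1%:M - (1 - alpha) *: A^T) *m (\col_j y j)) i ord0
    = y i - (1 - alpha) * \sum_j A j i * y j.
  rewrite mulmxBl mul1mx -scalemxAl !mxE; congr (_ - _ * _).
  by apply: eq_bigr => j _; rewrite !mxE.
have colE : (1%:M - (1 - alpha) *: A^T) *m influence alpha A
    = const_mx (alpha / N%:R).
  rewrite /influence -scalemxAr mulKVmx//.
  by apply/matrixP => i j; rewrite !mxE mulr1.
split=> [xE i|xE i].
  have -> : influence alpha A = \col_j x j; last by rewrite mxE.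
  apply: (can_inj (mulKmx uA)); rewrite colE.
  by apply/colP => j; rewrite mxE mxE1 {1}xE addrK.
have := mxE1 x i.
have -> : \col_j x j = influence alpha A by apply/colP => j; rewrite mxE xE.
by rewrite colE mxE => /eqP; rewrite eq_sym subr_eq => /eqP.
Qed.

Lemma influenceE A : row_stochastic A ->
  influence_eq A (fun=> alpha / N%:R) (fun i => influence alpha A i ord0).
Proof. by move=> hA; apply/influenceP. Qed.

Hypothesis N_gt0 : (0 < N)%N.

Lemma influence_l1_le1 A : row_stochastic A ->
  \sum_i `|influence alpha A i ord0| <= 1.
Proof.
have /andP[alpha_gt0 alpha_lt1] := halpha.
move=> hA; have := influence_eq_l1 hA (influenceE hA).
rewrite sumr_const card_ord -[X in _ <= X]mulr_natr ger0_norm; last first.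
  by rewrite divr_ge0// ?ler0n//; lra.
by rewrite mulfVK ?pnatr_eq0 -?lt0n// ger_pMr//; lra.
Qed.

(** Summing the equation over all vertices gives [S = alpha + (1 - alpha) * S]. *)
Lemma sum_influence A : row_stochastic A ->
  \sum_i influence alpha A i ord0 = 1.
Proof.
have /andP[alpha_gt0 alpha_lt1] := halpha.
move=> hA; have xE := influenceE hA.
have : \sum_i influence alpha A i ord0
    = alpha + (1 - alpha) * \sum_i influence alpha A i ord0.
  under [LHS]eq_bigr do rewrite xE.
  rewrite big_split /= sumr_const card_ord -[X in X + _]mulr_natr.
  rewrite mulfVK ?pnatr_eq0 -?lt0n// -mulr_sumr exchange_big /=.
  congr (_ + _ * _); apply: eq_bigr => j _.
  by rewrite -mulr_suml (proj2 hA) mul1r.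
by set S := \sum_i _ => ?; nra.
Qed.

(* The coordinates have sum [1] and absolute sum at most [1]. *)
Lemma influence_ge0 A i : row_stochastic A -> 0 <= influence alpha A i ord0.
Proof.
have /andP[alpha_gt0 alpha_lt1] := halpha.
move=> hA; set x := fun i => influence alpha A i ord0.
have d0 j : 0 <= `|x j| - x j by rewrite subr_ge0 ler_norm.
have : \sum_j (`|x j| - x j) = 0.
  apply/eqP; rewrite eq_le sumr_ge0// andbT sumrB sum_influence// subr_le0.
  exact: influence_l1_le1.
move=> /psumr_eq0P => /(_ (fun j _ => d0 j)) /(_ i isT) /eqP.
by rewrite subr_eq0 => /eqP; rewrite -/(x i) => <-.
Qed.

Lemma influence_ge A i : row_stochastic A ->
  alpha / N%:R <= influence alpha A i ord0.
Proof.
have /andP[alpha_gt0 alpha_lt1] := halpha.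
move=> hA; rewrite (influenceE hA) lerDl mulr_ge0//; first by lra.
by apply: sumr_ge0 => j _; rewrite mulr_ge0 ?influence_ge0 ?(proj1 hA).
Qed.

Lemma influence_dist U W (delta : R) : 0 <= delta ->
  row_stochastic U -> row_stochastic W ->
  (forall i j, (1 - delta) * U i j <= W i j) ->
  \sum_i `|influence alpha U i ord0 - influence alpha W i ord0|
    <= 2 * (1 - alpha) / alpha * delta.
Proof.
have /andP[alpha_gt0 alpha_lt1] := halpha.
move=> d0 hU hW UW.
set x := fun i => influence alpha U i ord0.
set y := fun i => influence alpha W i ord0.
set b := fun i => (1 - alpha) * \sum_j (U j i - W j i) * x j.
have xyE : influence_eq W b (fun i => x i - y i).
  move=> i; rewrite {1}/x {1}/y (influenceE hU) (influenceE hW) -/x -/y /b.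
  rewrite opprD addrACA subrr add0r -mulrBr -mulrDr -sumrB -big_split /=.
  by congr (_ * _); apply: eq_bigr => j _; rewrite -/(x j) -/(y j); ring.
have row_dist j : \sum_i `|U j i - W j i| <= 2 * delta.
  (* As [U - W <= delta * U] entrywise, [|U - W| <= 2 * delta * U - (U - W)]; the bracket sums to 0
     along a row. *)
  apply: (@le_trans _ _ (\sum_i (2 * delta * U j i - (U j i - W j i)))).
    apply: ler_sum => i _; rewrite ler_norml; have := UW j i.
    by have := proj1 hU j i; nra.
  rewrite !sumrB -mulr_sumr (proj2 hU) (proj2 hW); lra.
have : \sum_i `|b i| <= 2 * (1 - alpha) * delta.
  have a1 : 0 <= 1 - alpha by lra.
  under eq_bigr do rewrite normrM (ger0_norm a1).
  rewrite -mulr_sumr mulrAC [_ * (1 - alpha)]mulrC ler_wpM2l//.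
  apply: (@le_trans _ _ (\sum_i \sum_j `|U j i - W j i| * `|x j|)).
    apply: ler_sum => i _; apply: (le_trans (ler_norm_sum _ _ _)).
    by apply: ler_sum => j _; rewrite normrM.
  rewrite exchange_big /=.
  apply: (@le_trans _ _ (\sum_j 2 * delta * `|x j|)).
    by apply: ler_sum => j _; rewrite -mulr_suml ler_wpM2r.
  rewrite -mulr_sumr -[X in _ <= X]mulr1 ler_wpM2l//; first by lra.
  exact: influence_l1_le1.
move: (influence_eq_l1 hW xyE) => /le_trans /[apply].
by rewrite [_ / alpha * delta]mulrAC ler_pdivlMr 1?mulrC//; lra.
Qed.

End Influence.

(** * Comparison of l^p norms and continuity of p-th powers *)

Section LpNorm.
Variables (R : realType) (I : finType) (p : R).
Hypothesis p_ge1 : 1 <= p.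
Implicit Types (S : {set I}) (v : I -> R).

Lemma ler_coord_lpnorm S v i : i \in S -> `|v i| <= lpnorm p S v.
Proof.
have p1 := p_ge1; have p0 : p != 0 by lra.
move=> iS; rewrite /lpnorm -{1}[`|v i|]powRr1// -[1](mulfV p0) powRrM.
apply: ge0_ler_powR; rewrite ?invr_ge0 ?nnegrE ?powR_ge0//; first by lra.
  by apply: sumr_ge0 => j _; exact: powR_ge0.
by rewrite (bigD1 i)//= lerDl; apply: sumr_ge0 => j _; exact: powR_ge0.
Qed.

(** With [T] the l^1 norm, each [|v i|^p] is at most [|v i| * T^(p-1)], and these bounds sum to
    [T^p]. *)
Lemma ler_lpnorm_l1 S v : lpnorm p S v <= \sum_(i in S) `|v i|.
Proof.
have p1 := p_ge1; have p0 : p != 0 by lra.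
set T := \sum_(i in S) _; have T0 : 0 <= T by apply: sumr_ge0.
rewrite /lpnorm -[leRHS]powRr1// -[1](mulfV p0) powRrM.
apply: ge0_ler_powR; rewrite ?invr_ge0 ?nnegrE ?powR_ge0//; first by lra.
  by apply: sumr_ge0 => j _; exact: powR_ge0.
rewrite -mulr_powRB1//; last by lra.
rewrite {1}/T mulr_suml; apply: ler_sum => i iS.
rewrite -mulr_powRB1//; last by lra.
rewrite ler_wpM2l//; apply: ge0_ler_powR; rewrite ?nnegrE//; first by lra.
by rewrite /T (bigD1 i)//= lerDl; apply: sumr_ge0.
Qed.

(** At 0 the function is squeezed between 0 and [|x|], because [|x|^p <= |x|] when [|x| <= 1];
    elsewhere it is a composite with a differentiable power. *)
Lemma continuous_norm_powR : continuous (fun x : R => `|x| `^ p).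
Proof.
have p1 := p_ge1; move=> x.
have [->|x0] := eqVneq x 0.
  rewrite /continuous_at normr0 powR0; last by lra.
  apply: (@squeeze_cvgr _ _ _ _ (fun=> 0) (fun x => `|x|)).
  - near=> y; rewrite powR_ge0 /=.
    have [->|y0] := eqVneq y 0; first by rewrite normr0 powR0//; lra.
    apply: ge1r_powR => //; rewrite normr_gt0 y0 /=.
    near: y; apply/nbhs_normP; exists 1 => //= y.
    by rewrite /= sub0r normrN => /ltW.
  - exact: cvg_cst.
  - by rewrite -[X in _ --> X](@normr0 _ R); exact: norm_continuous.
rewrite /continuous_at; have nx0 : 0 < `|x| by rewrite normr_gt0.
apply: (@continuous_comp _ _ _ (fun x : R => `|x|) (fun y => y `^ p)).
  exact: norm_continuous.
apply: differentiable_continuous; apply/derivable1_diffP.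
by have [] := is_derive1_powR p nx0.
Unshelve. all: by end_near. Qed.

End LpNorm.

(** * The error as a function of the firm labelling *)

Section FirmError.
Variables (R : realType) (N : nat) (p : R).
Implicit Types x y : 'I_N -> R.

Definition firm_error {F : finType} (phi : 'I_N -> F) x y : R :=
  lpnorm p [set phi i | i : 'I_N]%SET
    (fun f => \sum_(i | phi i == f) x i - \sum_(i | phi i == f) y i).

(** Naming each firm by one of its vertices reduces arbitrary label types to the finitely many
    self-maps of the vertex set. *)
Lemma firm_error_relabel (F : finType) (phi : 'I_N -> F) :
  (0 < N)%N -> exists psi : {ffun 'I_N -> 'I_N},
    forall x y, firm_error phi x y = firm_error psi x y.
Proof.
(* The default vertex is reached only by labels that do not occur. *)
move=> N0; pose r f := odflt (Ordinal N0) [pick j | phi j == f].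
have phir i : phi (r (phi i)) = phi i.
  by rewrite /r; case: pickP => [j /eqP//|/(_ i)]; rewrite eqxx.
exists [ffun i => r (phi i)] => x y; rewrite /firm_error /lpnorm.
have -> : [set [ffun i => r (phi i)] i | i : 'I_N]%SET
    = [set r f | f in [set phi i | i : 'I_N]]%SET.
  by rewrite -imset_comp; apply: eq_imset => i /=; rewrite ffunE.
rewrite [in RHS]big_imset /=; last first.
  move=> f g /imsetP[i _ ->] /imsetP[j _ ->] rij.
  by rewrite -(phir i) rij phir.
congr (_ `^ _); apply: eq_bigr => f /imsetP[k _ ->].
have phiE i : ([ffun i => r (phi i)] i == r (phi k)) = (phi i == phi k).
  by rewrite ffunE; apply/eqP/eqP => [rik|->//]; rewrite -(phir i) rik phir.
by congr (`|_ - _| `^ _); apply: eq_bigl => i; rewrite phiE.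
Qed.

Hypothesis p_ge1 : 1 <= p.

Lemma firm_error_le_l1 (F : finType) (phi : 'I_N -> F) x y :
  firm_error phi x y <= \sum_i `|x i - y i|.
Proof.
apply: (le_trans (ler_lpnorm_l1 p_ge1 _ _)).
rewrite [leRHS](partition_big phi (mem [set phi i | i : 'I_N]%SET)) /=;
  last by move=> i _; exact: imset_f.
by apply: ler_sum => f _; rewrite -sumrB; exact: ler_norm_sum.
Qed.

Lemma firm_error_id_ge x y i : `|x i - y i| <= firm_error id x y.
Proof.
have := @ler_coord_lpnorm _ _ p p_ge1 [set id i | i : 'I_N]%SET
  (fun f => \sum_(i | id i == f) x i - \sum_(i | id i == f) y i) i.
by rewrite /= !big_pred1_eq; apply; exact: imset_f.
Qed.

(** Lets the maximisation work with the sum of p-th powers, without the outer root. *)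
Lemma ler_firm_error (F : finType) (phi : 'I_N -> F) x y x' y' :
  \sum_(f in [set phi i | i : 'I_N]%SET)
    `|\sum_(i | phi i == f) x i - \sum_(i | phi i == f) y i| `^ p <=
  \sum_(f in [set phi i | i : 'I_N]%SET)
    `|\sum_(i | phi i == f) x' i - \sum_(i | phi i == f) y' i| `^ p ->
  firm_error phi x y <= firm_error phi x' y'.
Proof.
have p1 := p_ge1; apply: ge0_ler_powR.
- by rewrite invr_ge0; lra.
- by rewrite nnegrE; apply: sumr_ge0 => f _; exact: powR_ge0.
- by rewrite nnegrE; apply: sumr_ge0 => f _; exact: powR_ge0.
Qed.

End FirmError.

(** * Reduction from data to pairs of stochastic matrices *)

Section Feasible.
Variables (R : realType) (N : nat).
Implicit Types U W : 'M[R]_N.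

(* Normalising the rows of [criticality] and of the observed data [ct], the
   pairs (true, observed) of linkage matrices are those satisfying this. *)
Definition feasible (delta : R) W U :=
  [/\ row_stochastic W, row_stochastic U, forall i, W i i = 0
    & forall i j, (1 - delta) * U i j <= W i j].

Lemma linkage_row_stochastic (c : 'M[R]_N) : (forall i j, 0 <= c i j) ->
  (forall i, 0 < \sum_k c i k) -> row_stochastic (linkage c).
Proof.
move=> c0 cs; split=> [i j|i]; first by rewrite mxE divr_ge0// ltW.
by under eq_bigr do rewrite mxE; rewrite -mulr_suml mulfV// gt_eqF.
Qed.

Lemma linkage_scale (W : 'M[R]_N) (a : R) : a != 0 -> row_stochastic W ->
  linkage (a *: W) = W.
Proof.
move=> a0 [_ W1]; apply/matrixP => i j; rewrite !mxE.
under eq_bigr do rewrite mxE.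
by rewrite -mulr_sumr W1 mulr1 mulrAC mulfV// mul1r.
Qed.

(** Forwards, multiply [ct i j <= c i j] by the bound on the missing share. Backwards, take [W] as
    criticalities and [(1 - delta) *: U] as observed data; giving each vertex its own good keeps the
    vertices distinct for every [phi]. *)
Lemma possible_errorsP (alpha p delta e : R) : (0 < N)%N -> 0 <= delta < 1 ->
  possible_errors alpha N p delta e <->
  exists (phi : {ffun 'I_N -> 'I_N}) (W U : 'M[R]_N), feasible delta W U /\
    e = firm_error p phi (fun i => influence alpha U i ord0)
                         (fun i => influence alpha W i ord0).
Proof.
move=> N0 /andP[d0 d1]; have d1' : 0 < 1 - delta by rewrite subr_gt0.
split=> [[G [ct [obs miss ->]]]|[phi [W [U [[hW hU Wd UW] ->]]]]].
  have [psi psiE] := firm_error_relabel p (@firm _ _ G) N0.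
  exists psi, (linkage (criticality G)), (linkage ct); split; last first.
    by rewrite -psiE.
  have s0 := @criticality_sum_gt0 _ _ G.
  have t0 i : 0 < \sum_k ct i k.
    by apply: lt_le_trans (miss i); rewrite mulr_gt0.
  split.
  - by apply: linkage_row_stochastic => //; exact: criticality_ge0.
  - by apply: linkage_row_stochastic => // i j; case/andP: (obs i j).
  - exact: linkage_diag0.
  - move=> i j; rewrite !mxE mulrA ler_pdivrMr// mulrAC ler_pdivlMr//.
    have /andP[ct0 ctc] := obs i j.
    rewrite mulrAC mulrC; apply: ler_pM => //; first by rewrite mulr_ge0// ltW.
have one : @linkage R N (1 *: W) = W by apply: linkage_scale.
rewrite scale1r in one.
have inj : injective (fun i => (phi i, id i)) by move=> i j [].
have Ws i : 0 < \sum_k W i k by rewrite (proj2 hW).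
have diag i : linkage W i i = 0 by rewrite one.
pose G := Network inj (proj1 hW) Ws diag.
exists G, ((1 - delta) *: U); split.
- by move=> i j; rewrite !mxE UW mulr_ge0 ?(proj1 hU) ?(ltW d1').
- move=> i; rewrite (proj2 hW) mulr1; under eq_bigr do rewrite mxE.
  by rewrite -mulr_sumr (proj2 hU) mulr1.
- by rewrite /importance_error /= one linkage_scale ?gt_eqF.
Qed.

End Feasible.

(** * Closed sets defined by continuous functions *)

Section ClosedConditions.
Variables (R : realType) (T : topologicalType).

Lemma continuous_sum (I : Type) (r : seq I) (P : pred I) (f : I -> T -> R) :
  (forall i, P i -> continuous (f i)) ->
  continuous (fun t => \sum_(i <- r | P i) f i t).
Proof.
move=> fc t; apply: cvg_big => [|i Pi]; last exact: fc.
by move=> z; exact: add_continuous.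
Qed.

Lemma closed_forall (I : Type) (P : I -> T -> Prop) :
  (forall i, closed [set t | P i t]) -> closed [set t | forall i, P i t].
Proof.
move=> Pc; have -> : [set t | forall i, P i t] = \bigcap_i [set t | P i t].
  by apply/seteqP; split=> [t Pt i _|t Pt i]; exact: Pt.
exact: closed_bigI.
Qed.

Lemma closed_le_continuous (f g : T -> R) : continuous f -> continuous g ->
  closed [set t | f t <= g t].
Proof.
move=> fc gc.
have -> : [set t | f t <= g t] = (fun t => g t - f t) @^-1` [set x | 0 <= x].
  by apply/seteqP; split=> t /=; rewrite subr_ge0.
apply: preimage_closed; last exact: closed_ge.
by move=> t _; apply: continuousB; [exact: gc|exact: fc].
Qed.

Lemma closed_eq_continuous (f g : T -> R) : continuous f -> continuous g ->
  closed [set t | f t = g t].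
Proof.
move=> fc gc; have -> : [set t | f t = g t] =
    [set t | f t <= g t] `&` [set t | g t <= f t].
  by apply/seteqP; split=> t /= => [->//|[fg gf]]; apply/le_anti; rewrite fg gf.
by apply: closedI; exact: closed_le_continuous.
Qed.

Lemma continuous_funB (f g : T -> R) : continuous f -> continuous g ->
  continuous (fun t => f t - g t).
Proof. by move=> fc gc t; apply: continuousB; [exact: fc|exact: gc]. Qed.

Lemma continuous_affine (a b : R) (f : T -> R) : continuous f ->
  continuous (fun t => a + b * f t).
Proof.
move=> fc t; apply: cvgD; first exact: cvg_cst.
by apply: cvgM; [exact: cvg_cst|exact: fc].
Qed.

Lemma continuous_funM (f g : T -> R) : continuous f -> continuous g ->
  continuous (fun t => f t * g t).
Proof. by move=> fc gc t; apply: continuousM; [exact: fc|exact: gc]. Qed.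

End ClosedConditions.

(** * Existence of the maximum by compactness *)

Section Maximum.
Variables (R : realType) (N : nat) (alpha p delta : R).
Hypotheses (halpha : 0 < alpha < 1) (N_ge2 : (2 <= N)%N) (p_ge1 : 1 <= p).
Hypothesis hdelta : 0 <= delta < 1.

Lemma feasible_nonempty : exists W U : 'M[R]_N, feasible delta W U.
Proof.
have /andP[d0 d1] := hdelta; case: N N_ge2 => [//|[//|n]] _.
(* A self-map without fixed points, available from two vertices on, gives a stochastic matrix with
   zero diagonal. *)
pose s (i : 'I_n.+2) : 'I_n.+2 := if i == ord0 then ord_max else ord0.
pose W : 'M[R]_n.+2 := \matrix_(i, j) (j == s i)%:R.
have hW : row_stochastic W by exact: row_stochastic_fun.
exists W, W; split=> // [i|i j].
  by rewrite mxE /s; case: (eqVneq i ord0) => [->|/negPf ->].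
by rewrite ler_piMl ?(proj1 hW)//; lra.
Qed.

Let entry := (bool * 'I_N * option 'I_N)%type.
Let space := 'rV[R]_#|{: entry}|.

(* A point encodes two matrices (the observed one for [true], the true one for
   [false]), each with its influence vector: carrying the influence vector along
   makes its defining equation a closed condition. *)
Let coord (e : entry) (z : space) : R := z ord0 (enum_rank e).
Let mat b (z : space) : 'M[R]_N := \matrix_(i, j) coord (b, i, Some j) z.
Let vec b (z : space) i := coord (b, i, None) z.

Let coord_cont e : continuous (coord e).
Proof. exact: coord_continuous. Qed.

Let mat_cont b i j : continuous (fun z : space => mat b z i j).
Proof.
rewrite (_ : (fun z => mat b z i j) = coord (b, i, Some j)); last first.
  by apply/funext => z; rewrite mxE.
exact: coord_cont.
Qed.

Let vec_cont b i : continuous (fun z : space => vec b z i).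
Proof. exact: coord_cont. Qed.

Let K : set space := [set z : space | forall k, `[-1, 1]%classic (z ord0 k)] `&`
  ([set z : space | feasible delta (mat false z) (mat true z)] `&`
   [set z : space | forall b,
      influence_eq alpha (mat b z) (fun=> alpha / N%:R) (vec b z)]).

Let row_stochastic_closed b : closed [set z : space | row_stochastic (mat b z)].
Proof.
apply: closedI; apply: closed_forall => i.
  apply: closed_forall => j; apply: closed_le_continuous; last exact: mat_cont.
  exact: cst_continuous.
apply: closed_eq_continuous; last exact: cst_continuous.
by apply: continuous_sum => j _; exact: mat_cont.
Qed.

Let K_compact : compact K.
Proof.
have box : compact [set z : space | forall k, `[-1, 1]%classic (z ord0 k)].
  exact: (@rV_compact R _ (fun=> `[-1, 1]%classic)
    (fun=> @segment_compact R _ _)).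
apply: compact_closedI => //.
apply: closedI.
- have -> : [set z : space | feasible delta (mat false z) (mat true z)] =
    [set z | row_stochastic (mat false z)] `&`
    [set z | row_stochastic (mat true z)] `&`
    [set z | forall i, mat false z i i = 0] `&`
    [set z | forall i j, (1 - delta) * mat true z i j <= mat false z i j].
    by apply/seteqP; split=> z /= => [[]|[[[]]]].
  apply: closedI; last first.
    do 2![apply: closed_forall => ?]; apply: closed_le_continuous => //.
    by apply: continuous_funM; [exact: cst_continuous|exact: mat_cont].
  apply: closedI; first exact: closedI.
  apply: closed_forall => i; apply: closed_eq_continuous => //.
  exact: cst_continuous.
- apply: closed_forall => b; apply: closed_forall => i.
  apply: closed_eq_continuous => //.
  apply: continuous_affine; apply: continuous_sum => j _.
  by apply: continuous_funM; [exact: mat_cont|exact: vec_cont].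
Qed.

Let encode (W U : 'M[R]_N) : space := \row_k
  match enum_val k with
  | (b, i, Some j) => (if b then U else W) i j
  | (b, i, None) => influence alpha (if b then U else W) i ord0
  end.

Let mat_encode W U b : mat b (encode W U) = if b then U else W.
Proof. by apply/matrixP => i j; rewrite mxE /coord mxE enum_rankK. Qed.

Let vec_encode W U b i :
  vec b (encode W U) i = influence alpha (if b then U else W) i ord0.
Proof. by rewrite /vec /coord mxE enum_rankK. Qed.

(** The box [[-1, 1]] loses no feasible pair: entries of stochastic matrices lie in [[0, 1]] and
    influence vectors have l^1 norm at most 1. *)
Let K_encode W U : feasible delta W U -> K (encode W U).
Proof.
move=> WU; have [hW hU _ _] := WU; have N0 : (0 < N)%N by exact: ltnW.
have hb b : row_stochastic (if b then U else W) by case: b.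
split=> [k|]; last first.
  split; first by rewrite /= !mat_encode.
  move=> b; rewrite mat_encode; apply/(influenceP halpha _ (hb b)) => i.
  exact: vec_encode.
rewrite /= mxE in_itv /= -ler_norml.
case: (enum_val k) => [[b i] [j|]].
  rewrite ger0_norm ?(proj1 (hb b))// -(proj2 (hb b) i) (bigD1 j)//= lerDl.
  by apply: sumr_ge0 => k' _; exact: (proj1 (hb b)).
apply: le_trans (influence_l1_le1 halpha N0 (hb b)).
by rewrite (bigD1 i)//= lerDl; apply: sumr_ge0.
Qed.

Lemma firm_error_max (phi : 'I_N -> 'I_N) : exists WU : 'M[R]_N * 'M[R]_N,
  feasible delta WU.1 WU.2 /\ forall W U, feasible delta W U ->
  firm_error p phi (fun i => influence alpha U i ord0)
                   (fun i => influence alpha W i ord0) <=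
  firm_error p phi (fun i => influence alpha WU.2 i ord0)
                   (fun i => influence alpha WU.1 i ord0).
Proof.
pose h z := \sum_(f in [set phi i | i : 'I_N]%SET)
  `|\sum_(i | phi i == f) vec true z i
    - \sum_(i | phi i == f) vec false z i| `^ p.
have h_cont : continuous h.
  apply: continuous_sum => f _ z.
  apply: (@continuous_comp _ _ _ (fun z => \sum_(i | phi i == f) vec true z i -
    \sum_(i | phi i == f) vec false z i) (fun x => `|x| `^ p)).
    by apply: continuous_funB; apply: continuous_sum => i _; exact: vec_cont.
  exact: continuous_norm_powR.
have [W0 [U0 WU0]] := feasible_nonempty.
have [|c] := EVT_max_rV _ K_compact (continuous_subspaceT h_cont).
  by exists (encode W0 U0); exact: K_encode.
rewrite inE => -[_ [cf ce]] c_max; exists (mat false c, mat true c).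
have [hW hU _ _] := cf.
(* By uniqueness of the solution, the vectors carried by the maximiser are the influence vectors of
   its matrices. *)
have vecE b i : vec b c i = influence alpha (mat b c) i ord0.
  by move: i; apply/(influenceP halpha) => //; case: b.
split=> [//|W U WU].
have hWU := c_max _ (mem_set (K_encode WU)).
apply: (ler_firm_error p_ge1).
have hE z (A B : 'M[R]_N) :
    (forall i, vec true z i = influence alpha B i ord0) ->
    (forall i, vec false z i = influence alpha A i ord0) ->
  h z = \sum_(f in [set phi i | i : 'I_N]%SET)
    `|\sum_(i | phi i == f) influence alpha B i ord0
      - \sum_(i | phi i == f) influence alpha A i ord0| `^ p.
  move=> BE AE; apply: eq_bigr => f _; congr (`|_ - _| `^ _);
    by apply: eq_bigr => i _.
move: hWU; rewrite (hE _ W U (vec_encode W U true) (vec_encode W U false)).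
by rewrite (hE c _ _ (vecE true) (vecE false)).
Qed.

(** The best of the maxima for the finitely many labellings. *)
Lemma possible_errors_max : exists m,
  is_maximum (possible_errors alpha N p delta) m.
Proof.
have N0 : (0 < N)%N by exact: ltnW.
have [WU WUP] := choice (fun phi : {ffun 'I_N -> 'I_N} => firm_error_max phi).
pose err (phi : {ffun 'I_N -> 'I_N}) := firm_error p phi
  (fun i => influence alpha (WU phi).2 i ord0)
  (fun i => influence alpha (WU phi).1 i ord0).
pose phi0 : {ffun 'I_N -> 'I_N} := [ffun i => i].
have [phi _ phi_max] := @arg_maxP _ _ _ phi0 xpredT err isT.
exists (err phi); split.
  apply/possible_errorsP => //.
  by exists phi, (WU phi).1, (WU phi).2; split=> //; exact: (proj1 (WUP phi)).
move=> e /(possible_errorsP _ _ _ N0 hdelta)[psi [W [U [fWU ->]]]].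
exact: le_trans (proj2 (WUP psi) _ _ fWU) (phi_max psi isT).
Qed.

End Maximum.

(** * Linear upper and lower bounds in [delta] *)

Section Bounds.
Variables (R : realType) (N : nat) (alpha p delta : R).
Hypotheses (halpha : 0 < alpha < 1) (p_ge1 : 1 <= p) (hdelta : 0 <= delta < 1).

Lemma possible_errors_le (e : R) : (0 < N)%N ->
  possible_errors alpha N p delta e -> e <= 2 * (1 - alpha) / alpha * delta.
Proof.
move=> N0 /(possible_errorsP _ _ _ N0 hdelta)[phi [W [U [[hW hU _ UW] ->]]]].
apply: (le_trans (firm_error_le_l1 p_ge1 _ _ _)).
by apply: influence_dist => //; case/andP: hdelta.
Qed.

(* Every vertex uses vertex [0], except that vertices [0] and [1] use vertex
   [2]; a share [delta] of the inputs of the vertices [i >= 2] comes from vertex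
   [1] and is unobserved.  The observed score of [1] is then the minimal one,
   [alpha / N], while its true score exceeds this by
   [(1 - alpha) * delta * \sum_(i >= 2) y i], which is at least
   [(1 - alpha) * delta * alpha / 3]. *)
Lemma possible_errors_ge : (3 <= N)%N -> exists2 e : R,
  possible_errors alpha N p delta e & (1 - alpha) * alpha / 3 * delta <= e.
Proof.
have /andP[a0 a1] := halpha; have /andP[d0 d1] := hdelta.
case: N => [//|[//|[//|n]]] _.
pose v0 : 'I_n.+3 := inord 0; pose v1 : 'I_n.+3 := inord 1.
pose v2 : 'I_n.+3 := inord 2.
have v0E : v0 = 0%N :> nat by rewrite inordK.
have v1E : v1 = 1%N :> nat by rewrite inordK.
have v2E : v2 = 2%N :> nat by rewrite inordK.
pose s (i : 'I_n.+3) := if (i < 2)%N then v2 else v0.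
pose t (i : 'I_n.+3) := if (i < 2)%N then v2 else v1.
pose U : 'M[R]_n.+3 := \matrix_(i, j) (j == s i)%:R.
pose V : 'M[R]_n.+3 := \matrix_(i, j) (j == t i)%:R.
pose W : 'M[R]_n.+3 := (1 - delta) *: U + delta *: V.
have hU : row_stochastic U by exact: row_stochastic_fun.
have hV : row_stochastic V by exact: row_stochastic_fun.
have hW : row_stochastic W.
  split=> [i j|i].
    rewrite 3!mxE [(delta *: V) i j]mxE.
    by rewrite addr_ge0 ?mulr_ge0 ?(proj1 hU) ?(proj1 hV)//; lra.
  under eq_bigr do rewrite 2!mxE [(delta *: V) _ _]mxE.
  by rewrite big_split /= -!mulr_sumr (proj2 hU) (proj2 hV); lra.
have WE i j : W i j = (1 - delta) * U i j + delta * V i j.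
  by rewrite 2!mxE [(delta *: V) _ _]mxE.
have UW : feasible delta W U.
  split=> // [i|i j]; last by rewrite WE lerDl mulr_ge0 ?(proj1 hV).
  rewrite WE !mxE /s /t -!val_eqE /=; case: ltnP => [i2|i2].
    by rewrite v2E ltn_eqF// !mulr0 addr0.
  by rewrite v0E v1E !gtn_eqF ?(leq_trans _ i2)// !mulr0 addr0.
pose x i := influence alpha U i ord0; pose y i := influence alpha W i ord0.
exists (firm_error p (finfun id : {ffun 'I_n.+3 -> 'I_n.+3}) x y).
  by apply/possible_errorsP => //; exists (finfun id), W, U.
have -> : firm_error p (finfun id : {ffun 'I_n.+3 -> 'I_n.+3}) x y
    = firm_error p id x y.
  by congr firm_error; apply/funext => i; rewrite ffunE.
apply: le_trans (firm_error_id_ge p_ge1 x y v1).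
have U1 j : U j v1 = 0.
  rewrite mxE /s -val_eqE; case: ltnP => _ /=; last by rewrite v0E v1E.
  by rewrite v1E v2E.
have x1 : x v1 = alpha / n.+3%:R.
  rewrite /x (influenceE halpha hU) big1 ?mulr0 ?addr0// => j _.
  by rewrite U1 mul0r.
have y1 : y v1 = alpha / n.+3%:R
    + (1 - alpha) * (delta * \sum_(j < n.+3 | (2 <= j)%N) y j).
  rewrite /y (influenceE halpha hW); congr (_ + _ * _).
  rewrite mulr_sumr [RHS]big_mkcond /=; apply: eq_bigr => j _.
  rewrite WE U1 mulr0 add0r mxE /t -val_eqE; case: ltnP => _ /=.
    by rewrite v1E v2E mulr0 mul0r.
  by rewrite eqxx mulr1.
(* There are [N - 2] terms, each at least [alpha / N], and [(N - 2) / N >= 1 / 3] once [N >= 3]. *)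
have tail : alpha / 3 <= \sum_(j < n.+3 | (2 <= j)%N) y j.
  apply: (@le_trans _ _ (\sum_(j < n.+3 | (2 <= j)%N) alpha / n.+3%:R)).
    rewrite big_mkcond !big_ord_recl /= !add0r sumr_const card_ord -mulrS.
    rewrite -[leRHS]mulr_natr [leRHS]mulrAC ler_pdivrMr// mulrAC.
    have n0 : n.+3%:R != 0 :> R by rewrite pnatr_eq0.
    rewrite -{1}(divfK n0 alpha) -[leRHS]mulrA.
    apply: ler_wpM2l; first by rewrite divr_ge0 ?ler0n ?ltW.
    by rewrite -natrM ler_nat; lia.
  by apply: ler_sum => j _; exact: influence_ge.
have T0 : 0 <= \sum_(j < n.+3 | (2 <= j)%N) y j by apply: le_trans tail; lra.
rewrite distrC x1 y1 addrAC subrr add0r ger0_norm; last first.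
  by rewrite !mulr_ge0//; lra.
move: tail; set T := \sum_(j < _ | _) _ => tail.
have -> : (1 - alpha) * alpha / 3 * delta = (1 - alpha) * (delta * (alpha / 3)).
  by ring.
by rewrite !ler_wpM2l//; lra.
Qed.

End Bounds.

(** The constants are uniform in [N] and [p]. The lower bound starts at [N = 3]: for two vertices
    the zero diagonal forces [W] and [U] both to be the swap matrix, so the error is 0. *)
Theorem theorem7p1 (R : realType) (alpha : R) (halpha : 0 < alpha < 1) :
  exists M : nat -> R -> R -> R,
    [/\ forall (N : nat) (p delta : R),
          (2 <= N)%N -> 1 <= p -> 0 <= delta < 1 ->
          is_maximum (possible_errors alpha N p delta) (M N p delta),
        exists D K : R, [/\ 0 < D, 0 < K &
          forall (N : nat) (p : R), (2 <= N)%N -> 1 <= p ->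
            bigO_with D K (M N p) (fun delta => delta)]
      & exists D K : R, [/\ 0 < D, 0 < K &
          forall (N : nat) (p : R), (3 <= N)%N -> 1 <= p ->
            bigOmega_with D K (M N p) (fun delta => delta)]].
Proof.
have /andP[a0 a1] := halpha.
(* In the range covered by [MP] a maximum exists, so [xget] does not return its default 0 for want
   of one. *)
pose M N p delta : R := xget 0 (is_maximum (possible_errors alpha N p delta)).
have MP N p delta : (2 <= N)%N -> 1 <= p -> 0 <= delta < 1 ->
    is_maximum (possible_errors alpha N p delta) (M N p delta).
  move=> N2 p1 hd; apply: (xgetPex 0).
  exact: possible_errors_max.
exists M; split=> //.
- exists 1, (2 * (1 - alpha) / alpha); split=> //.
    by rewrite divr_gt0// mulr_gt0//; lra.
  move=> N p N2 p1 delta /andP[d0 d1].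
  have hd : 0 <= delta < 1 by rewrite ltW.
  apply: (possible_errors_le halpha p1 hd (ltnW N2)).
  by have [] := MP N p delta N2 p1 hd.
- exists 1, ((1 - alpha) * alpha / 3); split=> //.
    by rewrite divr_gt0// mulr_gt0//; lra.
  move=> N p N3 p1 delta /andP[d0 d1].
  have hd : 0 <= delta < 1 by rewrite ltW.
  have [e Ee le_e] := possible_errors_ge halpha p1 hd N3.
  apply: (le_trans le_e).
  by have [_] := MP N p delta (ltnW N3) p1 hd; exact.
Qed.
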